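(* Let $\mathcal{A}$ be a line arrangement of $d\ge 3$ lines in $\mathbb{P}^2$ with exponents $d_1\le d_2\le\ldots\le d_m$. Let $m(\mathcal{A})$ be the maximal multiplicity of a point in $\mathcal{A}$, and $n(\mathcal{A})$ the maximal multiplicity of a point in $\mathcal{A}\setminus\{p\}$, where $p$ is any point in $\mathcal{A}$ of multiplicity $m(\mathcal{A})$. Then one has $$m(\mathcal{A})-1\le t(\mathcal{A})+m(\mathcal{A})-1\le d_2\le d-n(\mathcal{A}),$$ where $t(\mathcal{A})=d_1+d_2-d+1\ge 0$ is the type of the arrangement $\mathcal{A}$. In particular, the equality $d_2=m(\mathcal{A})-1$ implies that $\mathcal{A}$ is free and $d_1=d-m(\mathcal{A})$, and for a non free line arrangement $\mathcal{A}$ one has $$m(\mathcal{A})\le d_2.$$ Moreover, the type $t(\mathcal{A})$ of the line arrangement $\mathcal{A}$ satisfies $$0\le t(\mathcal{A})\le d+1-m(\mathcal{A})-n(\mathcal{A}).$$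
   Context: A line arrangement $\mathcal{A}$ of $d$ lines in the complex projective plane $\mathbb{P}^2$ is regarded as the reduced curve $f=0$ of degree $d$ given by the union of its $d$ distinct lines, with $f\in S=\mathbb{C}[x,y,z]$ the product of the linear forms defining the lines. The multiplicity of a point of this curve is the number of lines of $\mathcal{A}$ passing through it; $\mathcal{A}\setminus\{p\}$ denotes the set of points of the curve other than $p$. Let $f_x,f_y,f_z$ be the partial derivatives of $f$. The graded $S$-module of Jacobian syzygies is $$D_0(\mathcal{A})=\{(a,b,c)\in S^3: af_x+bf_y+cf_z=0\};$$ a homogeneous syzygy $(a,b,c)$ has degree $k$ if $a,b,c$ are homogeneous of degree $k$. If $\rho_1,\ldots,\rho_m$ is a minimal set of homogeneous generators of $D_0(\mathcal{A})$, with degrees $d_j=\deg\rho_j$ ordered so that $d_1\le d_2\le\cdots\le d_m$, then $(d_1,\ldots,d_m)$ are called the exponents of $\mathcal{A}$. The arrangement $\mathcal{A}$ is called free if $D_0(\mathcal{A})$ is a free $S$-module, equivalently $m=2$. *)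

(* Defs.v *)
From HB Require Import structures.
From mathcomp Require Import all_boot all_order all_algebra.
From mathcomp Require Import mpoly complex reals.

Set Implicit Arguments.
Unset Strict Implicit.
Unset Printing Implicit Defensive.

Import GRing.Theory.
Local Open Scope ring_scope.

Section LineArrangements.

Variable K : fieldType.

(* Points of P^2 and, through their equations, lines of P^2 are represented by
   nonzero coordinate vectors, taken up to proj_eq. *)
Definition proj_eq (u v : 'rV[K]_3) : Prop := exists2 c : K, c != 0 & u = c *: v.

Record line_arrangement (d : nat) := LineArrangement {
  line :> 'I_d -> 'rV[K]_3;
  line_neq0 : forall i, line i != 0;
  line_distinct : forall i j, i != j -> ~ proj_eq (line i) (line j)
}.

Definition linear_form (u : 'rV[K]_3) : {mpoly K[3]} :=
  \sum_(i < 3) u 0 i *: 'X_i.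

Section Arrangement.

Variables (d : nat) (A : line_arrangement d).

Definition arr_poly : {mpoly K[3]} := \prod_(j < d) linear_form (A j).

Definition on_curve (p : 'rV[K]_3) : Prop := p != 0 /\ arr_poly.@[p 0] = 0.

Definition mult (p : 'rV[K]_3) : nat :=
  #|[set j : 'I_d | (linear_form (A j)).@[p 0] == 0]|.

Definition max_mult_on (P : 'rV[K]_3 -> Prop) (k : nat) : Prop :=
  (exists2 q, P q & mult q = k) /\ (forall q, P q -> (mult q <= k)%N).

Definition is_max_mult (m : nat) : Prop := max_mult_on on_curve m.

Definition is_max_mult_away (p : 'rV[K]_3) (n : nat) : Prop :=
  max_mult_on (fun q => on_curve q /\ ~ proj_eq q p) n.

Definition syzygy (r : 'rV[{mpoly K[3]}]_3) : Prop :=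
  \sum_(i < 3) r 0 i * arr_poly^`M(i) = 0.

End Arrangement.

Definition homog_of_degree (k : nat) (r : 'rV[{mpoly K[3]}]_3) : Prop :=
  forall i, r 0 i \is k.-homog.

Definition generates (D : 'rV[{mpoly K[3]}]_3 -> Prop) (I : finType)
    (J : {set I}) (rho : I -> 'rV[{mpoly K[3]}]_3) : Prop :=
  forall r, D r <->
    exists c : I -> {mpoly K[3]}, r = \sum_(j in J) c j *: rho j.

Definition minimally_generates (D : 'rV[{mpoly K[3]}]_3 -> Prop) (I : finType)
    (rho : I -> 'rV[{mpoly K[3]}]_3) : Prop :=
  generates D [set: I] rho /\
  forall J : {set I}, J \proper [set: I] -> ~ generates D J rho.

Definition free_module (D : 'rV[{mpoly K[3]}]_3 -> Prop) : Prop :=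
  exists (k : nat) (b : 'I_k -> 'rV[{mpoly K[3]}]_3),
    generates D [set: 'I_k] b /\
    forall c : 'I_k -> {mpoly K[3]},
      \sum_j c j *: b j = 0 -> forall j, c j = 0.

Definition free_arrangement d (A : line_arrangement d) : Prop :=
  free_module (syzygy A).

(* The list is indexed from 0: the exponent d_j of the literature is
   nth 0 ds j.-1.  A minimal generator is nonzero, hence has a unique degree,
   although 0 is homogeneous of every degree. *)
Definition exponents d (A : line_arrangement d) (ds : seq nat) : Prop :=
  sorted leq ds /\
  exists rho : 'I_(size ds) -> 'rV[{mpoly K[3]}]_3,
    minimally_generates (syzygy A) rho /\
    forall j : 'I_(size ds), homog_of_degree (nth 0%N ds j) (rho j).

End LineArrangements.

Definition arr_type (d d1 d2 : nat) : int := d1%:Z + d2%:Z - d%:Z + 1.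

(* Main.v *)
Require Import Defs.
From HB Require Import structures.
From mathcomp Require Import all_boot all_order all_algebra.
From mathcomp Require Import mpoly complex reals.
From mathcomp Require Import boolp ring zify.

(** Write f for the product of the d linear forms, X = (x, y, z), and r . s and
    r x s for the dot and cross products of polynomial vectors, so that a
    syzygy is an r with r . grad f = 0.

    Upper bounds on the exponents.  Let p be a point of multiplicity m, and
    let h be the product of the forms of the d - m lines that avoid p.  As
    f = g h with the derivative of g along p equal to zero, Euler's formula
    shows that
          d h p - (p . grad h) X
    is a syzygy, of degree d - m.  For distinct points p and q the two
    syzygies are linearly independent, since X . (s_p x s_q) is a nonzero
    multiple of X . (p x q).  Comparing with the degrees of the generators,
    the first one gives d_1 <= d - m and the pair gives d_2 <= d - n
    (cross_point_syzygy, first_exponent_le, second_exponent_le).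

    Lower bound on their sum.  A syzygy r is tangent to each line l of the
    arrangement: l divides r . grad l.  Hence the determinant X . (r x s) of two
    syzygies vanishes on every line, so it is f q for some q (dvd_triple), and
    Euler's formula turns this into d (r x s) = q grad f (cross_syzygies).  If r
    and s are independent and homogeneous, comparing degrees shows that the
    degrees of r and s add up to at least d - 1.  In case of equality q is a
    nonzero constant; the same formula, applied to the cross products of an
    arbitrary syzygy with r and with s, then expresses that syzygy through r
    and s, which therefore form a basis (saito_free, Saito's criterion).

    It remains to see that the first two minimal generators are independent
    (generators_independent), and this is the only place where unique
    factorization enters.  If they are proportional, both are multiples of the
    primitive vector v proportional to the first one.  This v is again a
    syzygy; if it has smaller degree than the first generator it has to be
    zero, and otherwise it is a scalar multiple of it, so that the second
    generator is redundant.  The existence of v is proved for all polynomial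
    rings over a field, by a form of Gauss's lemma.

    The theorem is then arithmetic: d_1 + d_2 + 1 >= d, d_1 <= d - m and
    d_2 <= d - n give all the inequalities, while d_2 = m - 1 forces
    d_1 + d_2 + 1 = d and thus freeness. *)

Set Implicit Arguments.
Unset Strict Implicit.
Unset Printing Implicit Defensive.

Import GRing.Theory.
Local Open Scope ring_scope.

(** * Primitive parts of vectors over polynomial rings *)

Definition proportional (R : comNzRingType) (I : Type) (v w : I -> R) : Prop :=
  forall i j, v i * w j = v j * w i.

(** Over a domain with gcds these are the nonzero vectors whose entries have
    gcd 1; this formulation avoids any choice of a gcd. *)
Definition primitive_vec (R : comNzRingType) (I : Type) (v : I -> R) : Prop :=
  forall w, proportional v w -> exists h, forall i, w i = h * v i.

(** For a domain this is equivalent to the existence of gcds: g is a gcd of the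
    entries of u.  Stated for vectors, it is inherited by polynomial rings. *)
Definition has_primitive_parts (R : comNzRingType) : Prop :=
  forall (I : finType) (u : I -> R) (i0 : I), u i0 != 0 ->
  exists g v, (forall i, u i = g * v i) /\ primitive_vec v.

Lemma proportional_trans (R : idomainType) (I : Type) (u v w : I -> R) i0 :
  v i0 != 0 -> proportional u v -> proportional v w -> proportional u w.
Proof.
move=> nz uv vw i j; apply: (mulfI nz).
transitivity (u i0 * v i * w j); first by rewrite -uv; ring.
transitivity (u i0 * (v j * w i)); last by rewrite mulrA -uv; ring.
by rewrite -mulrA vw.
Qed.

(** The cofactor w is proportional to v = x w, hence w = h v and h x = 1. *)
Lemma primitive_common_factor (R : idomainType) (I : Type) (v w : I -> R) x i0 :
  primitive_vec v -> v i0 != 0 -> (forall i, v i = x * w i) ->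
  exists y, y * x = 1.
Proof.
move=> prim nz e; have [h eh] : exists h, forall i, w i = h * v i.
  by apply: prim => i j; rewrite !e; ring.
exists h; apply: (mulIf nz); rewrite mul1r [RHS]e eh; ring.
Qed.

Lemma has_primitive_parts_units (R : comNzRingType) :
  (forall x : R, x != 0 -> exists y, y * x = 1) -> has_primitive_parts R.
Proof.
move=> inv I u i0 /inv [y yu]; exists 1, u; split=> [i|w uw]; first by rewrite mul1r.
exists (w i0 * y) => i; rewrite -mulrA -[LHS]mul1r -yu -mulrA uw; ring.
Qed.

Section GaussLemma.

Variable R : idomainType.
Hypothesis primR : has_primitive_parts R.

Definition coprime_content (c : R) (q : {poly R}) : Prop :=
  forall x z q', c = x * z -> q = x *: q' -> exists y, y * x = 1.

Lemma size_drop_lead (q : {poly R}) : q != 0 ->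
  (size (q - lead_coef q *: 'X^((size q).-1))%R < size q)%N.
Proof.
move=> nz; have sq : (0 < size q)%N by rewrite size_poly_gt0.
rewrite -(prednK sq) ltnS; apply/leq_sizeP => j lej.
rewrite coefB coefZ coefXn lead_coefE.
case: eqP => [->|ne]; first by rewrite mulr1 subrr.
rewrite mulr0 subr0 nth_default //; move: lej; rewrite leq_eqVlt => /orP[/eqP e|].
  by case: ne.
by rewrite prednK.
Qed.

(** Gauss's lemma for a constant c coprime to the content of q.  Let a and b be
    the leading coefficients of q and u.  Write c = y c1 and a = y a1 with c1
    and a1 coprime; c1 divides b because c divides a b.  Dropping the leading
    term of u, induction shows that c1 divides u = c1 U.  What is left is that
    y divides q U; as y divides a, the leading term of q can be dropped, and
    induction shows that y divides U.  The number n bounds the sizes, for the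
    sake of the induction. *)
Lemma gauss_coprime n (c : R) (q u : {poly R}) :
  (size q + size u < n)%N -> coprime_content c q ->
  (exists e, q * u = c *: e) -> exists u', u = c *: u'.
Proof.
elim: n c q u => // n IH c q u; rewrite ltnS => len cop [e qu].
have [->|nzu] := eqVneq u 0; first by exists 0; rewrite scaler0.
have [q0|nzq] := eqVneq q 0.
  have [||y yc] := cop c 1 0; rewrite ?mulr1 ?scaler0 //.
  by exists (y *: u); rewrite scalerA mulrC yc scale1r.
set a := lead_coef q; set b := lead_coef u.
have nza : a != 0 by rewrite lead_coef_eq0.
pose ca (t : bool) := if t then c else a.
have [y [v [ev prv]]] := primR (u := ca) (i0 := false) nza.
have ec : c = y * v true := ev true.
have ea : a = y * v false := ev false.
have nzy : y != 0 by apply: contraNneq nza => y0; rewrite ea y0 mul0r.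
have nzv : v false != 0 by apply: contraNneq nza => y0; rewrite ea y0 mulr0.
have [h eb] : exists h, b = h * v true.
  have [|h eh] := prv (fun t : bool => if t then b else lead_coef e).
    have E : v true * lead_coef e = v false * b.
      apply: (mulfI nzy); rewrite !mulrA -ec -ea -lead_coefM qu lead_coefZ //.
    by case; case => //=.
  by exists h; exact: (eh true).
have [U eU] : exists U, u = v true *: U.
  have [|||u1 eu1] := IH (v true) q (u - b *: 'X^((size u).-1)).
  - apply: leq_trans len; rewrite ltn_add2l; exact: size_drop_lead.
  - by move=> x z q' e1; apply: (cop x (y * z)); rewrite ec e1; ring.
  - exists (y *: e - h *: (q * 'X^((size u).-1))).
    rewrite mulrBr qu ec eb -!mul_polyC !polyCM; ring.
  exists (u1 + h *: 'X^((size u).-1)).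
  by rewrite -[LHS](subrK (b *: 'X^((size u).-1))) eu1 eb -!mul_polyC !polyCM; ring.
have nzv1 : v true != 0 by apply: contraNneq nzu => v0; rewrite eU v0 scale0r.
have qU : q * U = y *: e.
  have nzP : (v true)%:P != 0 by rewrite polyC_eq0.
  by apply: (mulfI nzP); rewrite mulrCA mul_polyC -eU qu ec -!mul_polyC !polyCM; ring.
have [|||U' eU'] := IH y (q - a *: 'X^((size q).-1)) U.
- apply: leq_trans len; rewrite eU size_scale // ltn_add2r; exact: size_drop_lead.
- move=> x z q' ey eq'; apply: (cop x (z * v true) (q' + (z * v false) *: 'X^((size q).-1))).
    by rewrite ec ey; ring.
  by rewrite -[LHS](subrK (a *: 'X^((size q).-1))) eq' ea ey -!mul_polyC !polyCM; ring.
- exists (e - v false *: ('X^((size q).-1) * U)).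
  by rewrite mulrBl qU ea -!mul_polyC !polyCM; ring.
by exists U'; rewrite eU eU' ec -!mul_polyC !polyCM; ring.
Qed.

(** Among the vectors proportional to u choose v whose entry at i0 has least
    size, and divide it by the content of all its coefficients to get v0.
    Pseudo-division at i0 shows that every w proportional to u satisfies
    l w = Q v0 with l a nonzero constant: the remainder vector would be smaller
    than v.  After removing the common content of l and Q, Gauss's lemma makes
    l divide the primitive v0, so l is a unit and w is a multiple of v0. *)
Lemma has_primitive_parts_poly : has_primitive_parts {poly R}.
Proof.
move=> I u i0 nz.
have [v [uv nzv] vmin] : exists2 v : I -> {poly R},
    proportional u v /\ v i0 != 0 &
    forall w, proportional u w -> (size (w i0) < size (v i0))%N -> w i0 = 0.
  (* minimality is over a proposition, made decidable classically *)
  pose P n := `[< exists v : I -> {poly R},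
    [/\ proportional u v, v i0 != 0 & size (v i0) = n] >].
  have exP : exists n, P n.
    by exists (size (u i0)); apply/asboolP; exists u; split=> // i j; rewrite mulrC.
  case: (ex_minnP exP) => n /asboolP [v [uv nzv sv]] nmin; exists v => // w uw lt.
  apply/eqP; apply: contraLR lt => nzw; rewrite -leqNgt sv; apply: nmin.
  by apply/asboolP; exists w.
pose N := (\max_i size (v i))%N.
pose cf (ik : I * 'I_N) := (v ik.1)`_ik.2.
have ltN : ((size (v i0)).-1 < N)%N.
  apply: (@leq_trans (size (v i0))); first by rewrite prednK // size_poly_gt0.
  exact: (leq_bigmax i0).
have [|g [cf' [ecf prcf]]] := primR (u := cf) (i0 := (i0, Ordinal ltN)).
  by rewrite /cf /= -lead_coefE lead_coef_eq0.
pose v0 i := \poly_(k < N) (if insub k is Some k' then cf' (i, k') else 0).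
have v0E i (k : 'I_N) : (v0 i)`_k = cf' (i, k).
  by rewrite coef_poly ltn_ord valK.
have vE i : v i = g *: v0 i.
  apply/polyP=> k; rewrite coefZ; case: (ltnP k N) => ltk.
    by rewrite (v0E i (Ordinal ltk)) -ecf.
  rewrite coef_poly ltnNge ltk /= mulr0 nth_default //.
  by apply: leq_trans ltk; apply: (leq_bigmax i).
have nzg : g != 0 by apply: contraNneq nzv => g0; rewrite vE g0 scale0r.
have nzv0 : v0 i0 != 0 by apply: contraNneq nzv => g0; rewrite vE g0 scaler0.
have sv0 : size (v0 i0) = size (v i0) by rewrite vE size_scale.
have uv0 : proportional u v0.
  apply: (proportional_trans nzv uv) => i j.
  by rewrite !vE -!mul_polyC; ring.
have v0prim : primitive_vec v0.
  move=> w v0w; have uw := proportional_trans nzv0 uv0 v0w.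
  pose l := lead_coef (v0 i0) ^+ scalp (w i0) (v0 i0).
  pose Q := w i0 %/ v0 i0.
  have nzl : l != 0 by rewrite expf_neq0 // lead_coef_eq0.
  pose w' i := l *: w i - Q * v0 i.
  have w'i0 : w' i0 = w i0 %% v0 i0.
    by rewrite /w' Pdiv.Idomain.divp_eq addrC addKr.
  have uw' : proportional u w'.
    move=> i j; rewrite /w' !mulrBr -!scalerAr uw; congr (_ - _).
    by rewrite mulrCA uv0; ring.
  have {}w'i0 : w' i0 = 0.
    by apply: vmin => //; rewrite w'i0 -sv0 Pdiv.Idomain.ltn_modp.
  have lw i : l *: w i = Q * v0 i.
    apply/eqP; rewrite -subr_eq0 -/(w' i); apply/eqP; apply: (mulfI nz).
    by rewrite uw' w'i0 !mulr0.
  pose lQ (k : option 'I_(size Q)) := if k is Some k' then Q`_k' else l.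
  have [x [z [ez prz]]] := primR (u := lQ) (i0 := None) nzl.
  have el : l = x * z None := ez None.
  have nzx : x != 0 by apply: contraNneq nzl => x0; rewrite el x0 mul0r.
  have nzz : z None != 0 by apply: contraNneq nzl => x0; rewrite el x0 mulr0.
  pose Q' := \poly_(k < size Q) (if insub k is Some k' then z (Some k') else 0).
  have Q'E (k : 'I_(size Q)) : Q'`_k = z (Some k).
    by rewrite coef_poly ltn_ord valK.
  have QE : Q = x *: Q'.
    apply/polyP=> k; rewrite coefZ; case: (ltnP k (size Q)) => ltk.
      by rewrite (Q'E (Ordinal ltk)) -ez.
    by rewrite coef_poly ltnNge ltk /= mulr0 nth_default.
  have zw i : Q' * v0 i = z None *: w i.
    have nzP : x%:P != 0 by rewrite polyC_eq0.
    by apply: (mulfI nzP); rewrite mulrA mul_polyC -QE -lw el -!mul_polyC !polyCM; ring.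
  have cop : coprime_content (z None) Q'.
    move=> y t q' e1 e2.
    apply: (primitive_common_factor
      (w := fun k : option 'I_(size Q) => if k is Some k' then q'`_k' else t) prz nzz).
    by case=> [k|//]; rewrite -Q'E e2 coefZ.
  have /fin_all_exists [v1 ev1] : forall i, exists v1, v0 i = z None *: v1.
    by move=> i; apply: (gauss_coprime (leqnn _) cop); exists (w i).
  have [y yz] : exists y, y * z None = 1.
    apply: (primitive_common_factor (i0 := (i0, Ordinal ltN))
      (w := fun ik : I * 'I_N => (v1 ik.1)`_ik.2) prcf).
      rewrite -v0E /= -sv0 -lead_coefE lead_coef_eq0 //.
    by case=> i k; rewrite -v0E ev1 coefZ.
  exists (y *: Q') => i; rewrite -scalerAl zw scalerA yz scale1r //.
have [h eh] : exists h, forall i, u i = h * v0 i.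
  by apply: v0prim => i j; rewrite mulrC uv0 mulrC.
by exists h, v0.
Qed.

End GaussLemma.

Lemma has_primitive_parts_iso (R S : comNzRingType) (F : {rmorphism R -> S})
    (G : {rmorphism S -> R}) :
  cancel F G -> cancel G F -> has_primitive_parts S -> has_primitive_parts R.
Proof.
move=> FK GK primS I u i0 nz.
have [|g [v [ev prv]]] := primS I (F \o u) i0.
  by rewrite /= -(rmorph0 F) (inj_eq (can_inj FK)).
exists (G g), (G \o v); split=> [i|w vw].
  by rewrite /= -rmorphM -ev /= FK.
have [|h eh] := prv (F \o w).
  by move=> i j; have := congr1 F (vw i j); rewrite /= !rmorphM !GK.
by exists (G h) => i; rewrite /= -rmorphM -eh /= FK.
Qed.

Section MpolyIso.
Variables (K : fieldType) (n : nat).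

(** The last variable is singled out by muni; evaluating the widened
    coefficients at that variable puts it back. *)
Definition muni_inv (p : {poly {mpoly K[n]}}) : {mpoly K[n.+1]} :=
  (map_poly (@mwiden n K) p).['X_ord_max].

Lemma muni_inv_is_additive : {morph muni_inv : p q / p - q}.
Proof. by move=> p q; rewrite /muni_inv rmorphB hornerD hornerN. Qed.

Lemma muni_inv_is_multiplicative : multiplicative muni_inv.
Proof.
by split=> [p q|]; rewrite /muni_inv ?rmorphM ?rmorph1 ?hornerM ?hornerE.
Qed.

HB.instance Definition _ := GRing.isZmodMorphism.Build _ _ muni_inv muni_inv_is_additive.
HB.instance Definition _ := GRing.isMultiplicative.Build _ _ muni_inv muni_inv_is_multiplicative.

Lemma muni_invD : {morph muni_inv : p q / p + q}.
Proof. exact: rmorphD. Qed.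

Lemma muni_monomial (m : 'X_{1..n.+1}) : @muni n K 'X_[m] =
  'X_[[multinom m (widen_ord (leqnSn n) i) | i < n]] *: 'X^(m ord_max).
Proof. by rewrite muniE msuppX big_seq1 mcoeffX eqxx scale1r. Qed.

Lemma muni_mwiden (c : {mpoly K[n]}) : muni (mwiden c) = c%:P.
Proof.
elim/mpolyind: c => [|a m p _ _ IH]; first by rewrite !rmorph0.
rewrite !rmorphD /= IH; congr (_ + _).
rewrite mwidenZ muniZ mwidenX muni_monomial mnmwiden_ordmax expr0 alg_polyC.
rewrite -mul_polyC -rmorphM /= mul_mpolyC; congr (_ *: 'X_[_])%:P.
by apply/mnmP=> i; rewrite mnmE mnmwiden_widen.
Qed.

Lemma muniX_ordmax : @muni n K 'X_ord_max = 'X.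
Proof.
rewrite muni_monomial mnm1E eqxx expr1.
suff -> : [multinom U_(ord_max)%MM (widen_ord (leqnSn n) i) | i < n] = 0%MM.
  by rewrite mpolyX0 scale1r.
apply/mnmP=> i; rewrite mnmE mnm1E mnm0E -val_eqE /=.
by rewrite gtn_eqF.
Qed.

Lemma muni_invK : cancel muni_inv (@muni n K).
Proof.
elim/poly_ind => [|p c IH]; first by rewrite !rmorph0.
rewrite !rmorphD !rmorphM /= IH; congr (_ * _ + _).
  by rewrite /muni_inv map_polyX hornerX muniX_ordmax.
by rewrite /muni_inv map_polyC hornerC muni_mwiden.
Qed.

Lemma muniK : cancel (@muni n K) muni_inv.
Proof.
elim/mpolyind => [|a m p _ _ IH]; first by rewrite !rmorph0.
(* the pattern keeps unification from unfolding the evaluation of a *: 'X_[m] *)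
rewrite muniD muni_invD [X in _ + X]IH; congr (_ + _).
rewrite muniZ muni_monomial scalerA /muni_inv map_polyZ map_polyXn hornerZ hornerXn.
rewrite mul_mpolyC /= mwidenZ mwidenX -mul_mpolyC -mulrA mul_mpolyC; congr (_ *: _).
rewrite mpolyXn -mpolyXD; congr 'X_[_]; apply/mnmP=> i.
rewrite mnmDE mulmnE mnm1E.
case: (unliftP ord_max i) => [j ->|->].
  have -> : lift ord_max j = widen_ord (leqnSn n) j by apply: val_inj; exact: lift_max.
  by rewrite mnmwiden_widen mnmE -val_eqE /= gtn_eqF ?muln0 ?addn0.
by rewrite mnmwiden_ordmax eqxx mul1n add0n.
Qed.

End MpolyIso.

Lemma has_primitive_parts_mpoly (K : fieldType) n : has_primitive_parts {mpoly K[n]}.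
Proof.
elim: n => [|n IH].
  apply: has_primitive_parts_units => x; rewrite (nvar0_mpolyC x) mpolyC_eq0 => nz.
  by exists ((x@_0%MM)^-1)%:MP; rewrite -rmorphM /= mulVf.
apply: (has_primitive_parts_iso (@muniK K n) (@muni_invK K n)).
exact: has_primitive_parts_poly.
Qed.

(** * Dot and cross products in dimension three *)

Section ThreeVectors.

Variable R : idomainType.
Implicit Types u v w : 'rV[R]_3.

Definition dot u v : R := \sum_(i < 3) u 0 i * v 0 i.

(** Indices are taken in Z/3, so that the three entries follow one formula. *)
Definition cross u v : 'rV[R]_3 :=
  \row_i (u 0 (i + 1) * v 0 (i - 1) - u 0 (i - 1) * v 0 (i + 1)).

Lemma ord3P (P : 'I_3 -> Prop) : P 0 -> P 1 -> P (-1) -> forall i, P i.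
Proof.
move=> P0 P1 P2 [[|[|[|//]]] lti].
- by rewrite (_ : Ordinal lti = 0) //; apply: val_inj.
- by rewrite (_ : Ordinal lti = 1) //; apply: val_inj.
by rewrite (_ : Ordinal lti = -1) //; apply: val_inj.
Qed.

Lemma dotE u v : dot u v = u 0 0 * v 0 0 + u 0 1 * v 0 1 + u 0 (-1) * v 0 (-1).
Proof.
rewrite /dot !big_ord_recl big_ord0 addr0 addrA.
by congr (_ * _ + _ * _ + _ * _); congr (_ _ _); apply: val_inj.
Qed.

Lemma crossE u v :
  [/\ cross u v 0 0 = u 0 1 * v 0 (-1) - u 0 (-1) * v 0 1,
      cross u v 0 1 = u 0 (-1) * v 0 0 - u 0 0 * v 0 (-1) &
      cross u v 0 (-1) = u 0 0 * v 0 1 - u 0 1 * v 0 0].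
Proof.
have e2 : 1 + 1 = -1 :> 'I_3 by apply: val_inj.
have e3 : -1 - 1 = 1 :> 'I_3 by apply: val_inj.
by split; rewrite mxE ?add0r ?sub0r ?subrr ?addNr ?e2 ?e3.
Qed.

Lemma cross_eq0P u v : cross u v = 0 <-> proportional (u 0) (v 0).
Proof.
have [e0 e1 e2] := crossE u v; split=> [c0|uv].
  have z i : cross u v 0 i = 0 by rewrite c0 mxE.
  rewrite z in e0; rewrite z in e1; rewrite z in e2.
  move/esym/subr0_eq: e0 => e0; move/esym/subr0_eq: e1 => e1.
  move/esym/subr0_eq: e2 => e2.
  by apply: ord3P; apply: ord3P => //; rewrite ?e0 ?e1 ?e2.
by apply/rowP=> i; rewrite !mxE uv subrr.
Qed.

Lemma cross_lin a b u v w :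
  cross (a *: u + b *: v) w = a *: cross u w + b *: cross v w.
Proof. by apply/rowP=> i; rewrite !mxE; ring. Qed.

Lemma crossC u v : cross u v = - cross v u.
Proof. by apply/rowP=> i; rewrite !mxE; ring. Qed.

Lemma crossvv u : cross u u = 0.
Proof. by apply/rowP=> i; rewrite !mxE; ring. Qed.

Lemma cross0v u : cross 0 u = 0.
Proof. by apply/rowP=> i; rewrite !mxE; ring. Qed.

(** Each minor of (u x v, g) is an entry of (u x v) x g = (u . g) v - (v . g) u,
    up to sign. *)
Lemma cross_orthogonal u v g : dot u g = 0 -> dot v g = 0 ->
  proportional (cross u v 0) (g 0).
Proof.
have [c0 c1 c2] := crossE u v; rewrite !dotE => ug vg.
have E i j : cross u v 0 i * g 0 j - cross u v 0 j * g 0 i = 0 ->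
    cross u v 0 i * g 0 j = cross u v 0 j * g 0 i by move/subr0_eq.
have z (x y : R) : x = 0 -> y = 0 -> forall a b : R, a * x + b * y = 0.
  by move=> -> -> a b; rewrite !mulr0 addr0.
have {}z := z _ _ ug vg.
apply: ord3P; apply: ord3P => //; apply: E; rewrite ?c0 ?c1 ?c2.
- by rewrite -[RHS](z (v 0 (-1)) (- u 0 (-1))); ring.
- by rewrite -[RHS](z (- v 0 1) (u 0 1)); ring.
- by rewrite -[RHS](z (- v 0 (-1)) (u 0 (-1))); ring.
- by rewrite -[RHS](z (v 0 0) (- u 0 0)); ring.
- by rewrite -[RHS](z (v 0 1) (- u 0 1)); ring.
- by rewrite -[RHS](z (- v 0 0) (u 0 0)); ring.
Qed.

Lemma proportional_dot x u v i : proportional (u 0) (v 0) ->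
  u 0 i * dot x v = v 0 i * dot x u.
Proof.
move=> uv; rewrite /dot !mulr_sumr; apply: eq_bigr => j _.
by rewrite mulrCA uv; ring.
Qed.

(** Cramer's rule: u_i times the determinant of (a, b, c) is a combination of
    a . u, b . u and c . u with minors as coefficients. *)
Lemma triple_eq0 a b c u : u != 0 ->
  dot a u = 0 -> dot b u = 0 -> dot c u = 0 -> dot a (cross b c) = 0.
Proof.
move=> nzu au bu cu.
have [i nz] : exists i, u 0 i != 0 by apply/rV0Pn.
apply: (mulfI nz); rewrite mulr0.
suff -> : u 0 i * dot a (cross b c) = dot a u * cross b c 0 i +
    dot b u * cross c a 0 i + dot c u * cross a b 0 i.
  by rewrite au bu cu !mul0r !addr0.
rewrite !dotE; have [-> -> ->] := crossE b c.
have [e1 e2 e3] := crossE c a; have [f1 f2 f3] := crossE a b.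
have [g1 g2 g3] := crossE b c.
by move: i {nz}; apply: ord3P; rewrite ?e1 ?e2 ?e3 ?f1 ?f2 ?f3 ?g1 ?g2 ?g3; ring.
Qed.

End ThreeVectors.

(** * Linear forms, their products, and gradients *)

Section LinearForms.
Variable K : fieldType.
Local Notation S := {mpoly K[3]}.
Implicit Types (r s : 'rV[S]_3) (h : S) (u w : 'rV[K]_3).

Definition grad h : 'rV[S]_3 := \row_i h^`M(i).
Definition coord_vec : 'rV[S]_3 := \row_i 'X_i.

Definition const_vec u : 'rV[S]_3 := map_mx (@mpolyC 3 K) u.

Lemma dot_gradM r h1 h2 :
  dot r (grad (h1 * h2)) = dot r (grad h1) * h2 + h1 * dot r (grad h2).
Proof.
rewrite /dot mulr_suml mulr_sumr -big_split /=; apply: eq_bigr => i _.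
by rewrite !mxE mderivM; ring.
Qed.

Lemma linear_formE u : linear_form u = dot coord_vec (const_vec u).
Proof.
by apply: eq_bigr => i _; rewrite !mxE mulrC mul_mpolyC.
Qed.

Lemma grad_linear_form u : grad (linear_form u) = const_vec u.
Proof.
apply/rowP=> i; rewrite !mxE raddf_sum (bigD1 i) //= big1 ?addr0 => [|j ne].
  rewrite mderivZ mderivX mnm1E eqxx scale1r -mul_mpolyC.
    suff -> : (U_(i) - U_(i) = 0 :> 'X_{1..3})%MM by rewrite mpolyX0 mulr1.
    by apply/mnmP=> k; rewrite mnmBE subnn mnm0E.
by rewrite mderivZ mderivX mnm1E (negbTE ne) scale0r scaler0.
Qed.

Lemma meval_linear_form u (x : 'I_3 -> K) : (linear_form u).@[x] = \sum_i u 0 i * x i.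
Proof.
by rewrite raddf_sum; apply: eq_bigr => i _ /=; rewrite mevalZ mevalXU.
Qed.

Lemma linear_form_eq0 u : (linear_form u == 0) = (u == 0).
Proof.
apply/eqP/eqP=> [e|->]; last first.
  by rewrite /linear_form big1 // => i _; rewrite mxE scale0r.
apply/rowP=> i; rewrite mxE.
have := meval_linear_form u (fun j => (j == i)%:R); rewrite e meval0 => /esym.
rewrite (bigD1 i) //= eqxx mulr1 big1 ?addr0 // => j /negbTE ->.
by rewrite mulr0.
Qed.

Lemma linear_form_is_linear : linear (@linear_form K).
Proof.
move=> c u v; rewrite /linear_form scaler_sumr -big_split; apply: eq_bigr => i _ /=.
by rewrite !mxE scalerDl scalerA.
Qed.
HB.instance Definition _ :=
  GRing.isLinear.Build K 'rV[K]_3 {mpoly K[3]} *:%R (@linear_form K) linear_form_is_linear.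

Lemma linear_form_homog u : linear_form u \is 1.-homog.
Proof. by apply: rpred_sum => i _; apply: rpredZ; rewrite dhomogX; apply/eqP/mdeg1. Qed.

Definition form_prod (t : seq 'rV[K]_3) : S := \prod_(u <- t) linear_form u.

Lemma form_prod_homog t : form_prod t \is (size t).-homog.
Proof.
elim: t => [|u t IH]; rewrite /form_prod ?big_nil ?big_cons ?dhomog1 //.
by rewrite -[size _]add1n; apply: dhomogM (linear_form_homog u) IH.
Qed.

Lemma form_prod_neq0 t : {in t, forall u, u != 0} -> form_prod t != 0.
Proof.
by move=> nz; rewrite prodf_seq_neq0; apply/allP=> u /nz; rewrite linear_form_eq0.
Qed.

(** A derivation multiplying each factor by e multiplies the product by e times
    the number of factors.  The case e = 1 is Euler's formula, the case e = 0
    says that forms vanishing at p have a product that is constant along p. *)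
Lemma dot_grad_form_prod r (e : S) t :
  {in t, forall u, dot r (const_vec u) = e * linear_form u} ->
  dot r (grad (form_prod t)) = e * (size t)%:R * form_prod t.
Proof.
elim: t => [|u t IH] E; rewrite /form_prod ?big_nil ?big_cons.
  rewrite mulr0 mul0r /dot big1 // => i _.
  by rewrite mxE -mpolyC1 mderivC mulr0.
rewrite dot_gradM IH => [|v tv]; last by rewrite E // inE tv orbT.
rewrite grad_linear_form E ?mem_head // /form_prod /= -nat1r.
by ring.
Qed.

(** If u . w = 1, this substitution moves a point in the direction w to the
    line of equation u; the polynomials that it kills are the multiples of that
    linear form. *)
Definition slide u w : 3.-tuple S := [tuple 'X_i - w 0 i *: linear_form u | i < 3].

Lemma slide_linear_form u w v : linear_form v \mPo slide u w =
  linear_form v - (\sum_i v 0 i * w 0 i) *: linear_form u.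
Proof.
rewrite {1}/linear_form raddf_sum scaler_suml -sumrB; apply: eq_bigr => i _ /=.
by rewrite comp_mpolyZ comp_mpolyXU -tnth_nth tnth_mktuple scalerBr scalerA.
Qed.

(** The substitution is the identity modulo the form of u on the variables,
    hence on all polynomials. *)
Lemma slide_diff u w h : exists q, h - (h \mPo slide u w) = linear_form u * q.
Proof.
pose Q h := exists q, h - (h \mPo slide u w) = linear_form u * q.
have QM h1 h2 : Q h1 -> Q h2 -> Q (h1 * h2).
  move=> [q1 e1] [q2 e2]; exists (h1 * q2 + q1 * (h2 \mPo slide u w)).
  rewrite rmorphM /= mulrDr mulrCA -e2 mulrA -e1.
  by ring.
have QC c : Q c%:MP by exists 0; rewrite comp_mpolyC subrr mulr0.
have QX i : Q 'X_i.
  exists (w 0 i)%:MP; rewrite comp_mpolyXU -tnth_nth tnth_mktuple.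
  by rewrite -mul_mpolyC; ring.
have QXm m : Q 'X_[m].
  rewrite mpolyXE_id; apply: big_ind => [||i _]; [exact: (QC 1)|exact: QM|].
  by elim: (m i) => [|k IH]; [exact: (QC 1) | rewrite exprS; apply: QM].
rewrite -/(Q h); elim/mpolyind: h => [|c m p _ _ [q1 e1]]; first exact: (QC 0).
have [q2 e2] : Q (c *: 'X_[m]) by rewrite -mul_mpolyC; apply: QM.
by exists (q2 + q1); rewrite mulrDr -e1 -e2 raddfD /=; ring.
Qed.

End LinearForms.

Section CrossMorphism.
Variables (R T : idomainType) (f : {rmorphism R -> T}).

Lemma rmorph_dot (u v : 'rV[R]_3) : f (dot u v) = dot (map_mx f u) (map_mx f v).
Proof. by rewrite rmorph_sum; apply: eq_bigr => i _; rewrite rmorphM !mxE. Qed.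

Lemma map_cross (u v : 'rV[R]_3) :
  map_mx f (cross u v) = cross (map_mx f u) (map_mx f v).
Proof. by apply/rowP=> i; rewrite !mxE rmorphB !rmorphM. Qed.

End CrossMorphism.

(** * Syzygies of an arrangement *)

Section Tangency.
Variables (K : fieldType) (d : nat) (A : line_arrangement K d).
Local Notation S := {mpoly K[3]}.
Implicit Types (r s : 'rV[S]_3) (h : S).

Lemma arr_polyE : arr_poly A = form_prod [seq A j | j <- enum 'I_d].
Proof. by rewrite /form_prod big_map big_enum. Qed.

Lemma arr_poly_homog : arr_poly A \is d.-homog.
Proof.
by have := form_prod_homog [seq A j | j <- enum 'I_d]; rewrite -arr_polyE size_map size_enum_ord.
Qed.

Lemma arr_poly_neq0 : arr_poly A != 0.
Proof.
by rewrite arr_polyE form_prod_neq0 // => _ /mapP[j _ ->]; apply: line_neq0.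
Qed.

Lemma euler_arr_poly : dot (coord_vec K) (grad (arr_poly A)) = d%:R * arr_poly A.
Proof.
rewrite arr_polyE (dot_grad_form_prod (e := 1)) => [|u _].
  by rewrite mul1r size_map size_enum_ord.
by rewrite mul1r linear_formE.
Qed.

(** Take for w a multiple of a basis vector.  A form killed by the projection
    to line i is proportional to the form of line i, so distinctness of the
    lines is what keeps the other forms alive. *)
Lemma slide_separates i : exists w,
  linear_form (A i) \mPo slide (A i) w = 0 /\
  forall j, j != i -> linear_form (A j) \mPo slide (A i) w != 0.
Proof.
have /rV0Pn[k nzk] := line_neq0 A i.
pose w : 'rV[K]_3 := \row_j ((j == k)%:R / A i 0 k).
have dotw (u : 'rV[K]_3) : \sum_j u 0 j * w 0 j = u 0 k / A i 0 k.
  rewrite (bigD1 k) //= mxE eqxx mul1r big1 ?addr0 // => j /negbTE ne.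
  by rewrite mxE ne mul0r mulr0.
exists w; split=> [|j ne]; rewrite slide_linear_form dotw.
  by rewrite divff // scale1r subrr.
rewrite -linearZ -linearB linear_form_eq0 subr_eq0; apply: contraPneq (@line_distinct _ _ A _ _ ne) => e.
apply; exists (A j 0 k / A i 0 k) => //; apply: contraNneq (line_neq0 A j) => e0.
by rewrite e e0 scale0r.
Qed.

(** Factors are collected one at a time: after projecting to line i, the
    product already collected does not vanish, so the cofactor does, and the
    form of line i divides it. *)
Lemma dvd_arr_poly h : (forall i, exists q, h = linear_form (A i) * q) ->
  exists q, h = arr_poly A * q.
Proof.
move=> dvd; rewrite arr_polyE; elim: (enum _) (enum_uniq 'I_d) => [|i t IH] /=.
  by exists h; rewrite /form_prod big_nil mul1r.
case/andP=> it /IH[q eq]; have [w [wi wj]] := slide_separates i.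
have [q' eq'] := slide_diff (A i) w q; exists q'.
suff q0 : q \mPo slide (A i) w = 0.
  by rewrite eq /form_prod /= big_cons -[in LHS](subr0 q) -q0 eq'; ring.
have nz : form_prod [seq A j | j <- t] \mPo slide (A i) w != 0.
  rewrite /form_prod big_map rmorph_prod prodf_seq_neq0; apply/allP=> j jt /=.
  by apply: wj; apply: contraNneq it => <-.
apply: (mulfI nz); rewrite mulr0 -rmorphM -eq; have [p ->] := dvd i.
by rewrite rmorphM /= wi mul0r.
Qed.

Lemma syzygyE r : syzygy A r <-> dot r (grad (arr_poly A)) = 0.
Proof.
rewrite /syzygy /dot; under [in X in _ <-> X]eq_bigr do rewrite mxE; by [].
Qed.

(** On f = l g the syzygy reads (r . grad l) g + l (r . grad g) = 0; on the
    line l = 0 the second term is zero while g is not. *)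
Lemma syzygy_tangent r i w : syzygy A r ->
  linear_form (A i) \mPo slide (A i) w = 0 ->
  (forall j, j != i -> linear_form (A j) \mPo slide (A i) w != 0) ->
  dot (map_mx (comp_mpoly (slide (A i) w)) r) (const_vec (A i)) = 0.
Proof.
move=> /syzygyE sr wi wj.
have := congr1 (comp_mpoly (slide (A i) w)) sr.
rewrite /arr_poly (bigD1 i) //= dot_gradM grad_linear_form.
rewrite rmorph0 rmorphD !rmorphM /= wi mul0r addr0 rmorph_dot => /eqP.
rewrite mulf_eq0 => /orP[/eqP <-|]; last first.
  by rewrite rmorph_prod /= => /prodf_eq0 [j ne /eqP e]; have := wj j ne; rewrite e eqxx.
by congr dot; apply/rowP=> k; rewrite !mxE /= comp_mpolyC.
Qed.

(** On the line of equation u the vectors X, r and s are all orthogonal to u,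
    hence their determinant is zero there. *)
Lemma dvd_triple r s : syzygy A r -> syzygy A s ->
  exists q, dot (coord_vec K) (cross r s) = arr_poly A * q.
Proof.
move=> sr ss; apply: dvd_arr_poly => i.
have [w [wi wj]] := slide_separates i.
have [q eq] := slide_diff (A i) w (dot (coord_vec K) (cross r s)).
exists q; rewrite -eq; suff -> : dot (coord_vec K) (cross r s) \mPo slide (A i) w = 0 by rewrite subr0.
rewrite rmorph_dot map_cross; apply: (triple_eq0 (u := const_vec (A i))).
- apply: contraNneq (line_neq0 A i) => e; apply/eqP/rowP=> k.
  by apply/eqP; have /rowP/(_ k)/eqP := e; rewrite !mxE mpolyC_eq0.
- have := congr1 (comp_mpoly (slide (A i) w)) (linear_formE (A i)).
  rewrite wi rmorph_dot => ->; congr dot.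
  by apply/rowP=> k; rewrite !mxE /= comp_mpolyC.
- exact: syzygy_tangent.
- exact: syzygy_tangent.
Qed.

(** Both r x s and grad f are orthogonal to r and s, hence proportional, and the
    ratio is read off by pairing them with X: X . (r x s) = f q and
    X . grad f = d f. *)
Lemma cross_syzygies r s : syzygy A r -> syzygy A s ->
  exists2 q, dot (coord_vec K) (cross r s) = arr_poly A * q &
  forall i, d%:R * cross r s 0 i = q * (arr_poly A)^`M(i).
Proof.
move=> sr ss; have [q eq] := dvd_triple sr ss; exists q => // i.
apply: (mulfI arr_poly_neq0); move/syzygyE: sr => sr; move/syzygyE: ss => ss.
have := proportional_dot (coord_vec K) i (cross_orthogonal sr ss).
by rewrite euler_arr_poly eq [grad _ 0 i]mxE => e; transitivity (cross r s 0 i * (d%:R * arr_poly A)); [|rewrite e]; ring.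
Qed.

End Tangency.

(** * The syzygy attached to a point *)

Lemma triple_shift (R : idomainType) (x p q : 'rV[R]_3) (a b a' b' : R) :
  dot x (cross (a *: p - b *: x) (a' *: q - b' *: x)) = a * a' * dot x (cross p q).
Proof.
rewrite !dotE; have [-> -> ->] := crossE p q.
have [-> -> ->] := crossE (a *: p - b *: x) (a' *: q - b' *: x).
by rewrite !mxE; ring.
Qed.

(** Multiplication by a variable restores the degree lost by derivation, and so
    avoids treating the degree k = 0 apart. *)
Lemma dhomog_mderivMX (K : fieldType) n k (h : {mpoly K[n]}) i j :
  h \is k.-homog -> h^`M(i) * 'X_j \is k.-homog.
Proof.
move=> /dhomogP homh; rewrite [h]mpolyE raddf_sum mulr_suml big_seq.
apply: rpred_sum => m /homh /= mk; rewrite mderivZ mderivX -!scalerAl.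
have [->|mi] := eqVneq (m i) 0%N; first by rewrite scale0r scaler0 rpred0.
do 2! apply: rpredZ; rewrite -mpolyXD dhomogX; apply/eqP.
have /submK e : (U_(i) <= m)%MM by rewrite lep1mP.
by move: mk; rewrite -{1}e /= !mdegD !mdeg1.
Qed.

Section PointSyzygy.
Variables (K : fieldType) (d : nat) (A : line_arrangement K d).
Local Notation S := {mpoly K[3]}.
Implicit Types (p q : 'rV[K]_3).

Definition through p j := (linear_form (A j)).@[p 0] == 0.
Definition away p : S := form_prod [seq A j | j <- enum 'I_d & ~~ through p j].

(** Modulo the Euler field X, this is the derivation along p multiplied by the
    forms of the lines to which it is not tangent; the multiple of X is the one
    that makes it annihilate f. *)
Definition point_syzygy p : 'rV[S]_3 :=
  (d%:R * away p) *: const_vec p - dot (const_vec p) (grad (away p)) *: coord_vec K.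

Lemma size_away p :
  size [seq A j | j <- enum 'I_d & ~~ through p j] = (d - mult A p)%N.
Proof.
have -> : mult A p = count (through p) (enum 'I_d).
  rewrite /mult -sum1_card -sum1_count big_enum_cond.
  by apply: eq_bigl => j; rewrite inE.
have e := count_predC (through p) (enum 'I_d).
rewrite size_enum_ord in e; rewrite size_map size_filter.
by rewrite (eq_count (a2 := predC (through p))) //; lia.
Qed.

Lemma away_homog p : away p \is (d - mult A p).-homog.
Proof. by rewrite -size_away form_prod_homog. Qed.

Lemma away_neq0 p : away p != 0.
Proof. by apply: form_prod_neq0 => _ /mapP[j _ ->]; apply: line_neq0. Qed.

Lemma point_syzygy_homog p : homog_of_degree (d - mult A p) (point_syzygy p).
Proof.
move=> i; rewrite !mxE; apply: rpredB.
  rewrite mulrC mul_mpolyC -mpolyC_nat mul_mpolyC.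
  by do 2! apply: rpredZ; exact: away_homog.
rewrite /dot mulr_suml; apply: rpred_sum => k _; rewrite !mxE -mulrA mul_mpolyC.
by apply: rpredZ; apply: dhomog_mderivMX; apply: away_homog.
Qed.

(** With f = g h and p . grad g = 0, the two terms are d h g (p . grad h) and
    (p . grad h) d f. *)
Lemma point_syzygy_syzygy p : syzygy A (point_syzygy p).
Proof.
apply/syzygyE; pose pencil := form_prod [seq A j | j <- enum 'I_d & through p j].
have fE : arr_poly A = pencil * away p.
  rewrite arr_polyE /form_prod -big_cat; apply: perm_big.
  by rewrite -map_cat perm_map // perm_sym; apply/permPl/perm_filterC.
have dp : dot (const_vec p) (grad pencil) = 0.
  rewrite (dot_grad_form_prod (e := 0)) ?mul0r // => u /mapP[j].
  rewrite mem_filter => /andP[/eqP + _] ->; rewrite meval_linear_form => e.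
  rewrite mul0r /dot -[RHS](mpolyC0 3) -e rmorph_sum; apply: eq_bigr => k _.
  by rewrite !mxE mulrC rmorphM.
have -> : dot (point_syzygy p) (grad (arr_poly A)) =
    d%:R * away p * dot (const_vec p) (grad (arr_poly A))
    - dot (const_vec p) (grad (away p)) * dot (coord_vec K) (grad (arr_poly A)).
  rewrite {1 2 4}/dot !mulr_sumr -sumrB; apply: eq_bigr => k _.
  by rewrite !mxE; ring.
rewrite euler_arr_poly fE dot_gradM dp; ring.
Qed.

(** The multiples of X drop out of the determinant with X, which is therefore
    d^2 h_p h_q times the form of the line through p and q. *)
Lemma cross_point_syzygy p q : d%:R != 0 :> K -> p != 0 -> q != 0 ->
  ~ proj_eq q p -> cross (point_syzygy p) (point_syzygy q) <> 0.
Proof.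
move=> nzd nzp nzq npq c0.
have := triple_shift (coord_vec K) (const_vec p) (const_vec q) (d%:R * away p)
  (dot (const_vec p) (grad (away p))) (d%:R * away q) (dot (const_vec q) (grad (away q))).
have dot0 : dot (coord_vec K) 0 = 0 by rewrite /dot big1 // => i _; rewrite [X in _ * X]mxE mulr0.
rewrite -!/(point_syzygy _) c0 dot0 => /esym/eqP; rewrite -map_cross -linear_formE !mulf_eq0 (negbTE (away_neq0 _)).
rewrite (negbTE (away_neq0 _)) !orbF -mpolyC_nat mpolyC_eq0 (negbTE nzd) /=.
rewrite linear_form_eq0 => /eqP/cross_eq0P pq; apply: npq.
have /rV0Pn[k nzk] := nzp.
have e : q = (q 0 k / p 0 k) *: p.
  by apply/rowP=> i; apply: (mulfI nzk); rewrite !mxE pq mulrA mulrCA divff // mulr1 mulrC.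
exists (q 0 k / p 0 k) => //; apply: contraNneq nzq => z.
by rewrite e z scale0r.
Qed.

End PointSyzygy.

(** * Homogeneous generators of a module *)

Section Graded.
Variables (K : fieldType).
Local Notation S := {mpoly K[3]}.

Lemma dhomog_msizeE n k (h : {mpoly K[n]}) : h != 0 -> h \is k.-homog -> msize h = k.+1.
Proof.
move=> nz homh; rewrite (mpolySpred _ nz); congr _.+1.
exact: dhomog_uniq nz (dhomog_msize homh) homh.
Qed.

Lemma pihomogMr n k e (c q : {mpoly K[n]}) : q \is e.-homog ->
  pihomog mdeg k (c * q) = if (e <= k)%N then pihomog mdeg (k - e) c * q else 0.
Proof.
move=> homq; have D l : pihomog mdeg k (pihomog mdeg l c * q) =
    if (l + e == k)%N then pihomog mdeg l c * q else 0.
  have hom : pihomog mdeg l c * q \is (l + e).-homog by apply: dhomogM homq; apply: pihomogP.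
  by case: eqP => [<-|/eqP ne]; [apply: pihomog_dE | apply: pihomog_ne0 ne hom].
pose N := maxn (msize c) k.+1.
rewrite {1}(pihomog_partitionE (k := N) (mf := mdeg) (p := c)) ?leq_maxl //.
rewrite mulr_suml raddf_sum /=; under eq_bigr do rewrite D.
case: leqP => lek; last first.
  by apply: big1 => l _; case: eqP => // e1; lia.
have ltN : (k - e < N)%N by rewrite /N; lia.
rewrite (bigD1 (Ordinal ltN)) //= subnK // eqxx big1 ?addr0 // => l ne.
case: eqP => // e1; case/eqP: ne; apply: val_inj => /=; lia.
Qed.

Variables (I : finType) (D : 'rV[S]_3 -> Prop) (rho : I -> 'rV[S]_3) (e : I -> nat).
Hypothesis genD : generates D [set: I] rho.
Hypothesis homrho : forall j, homog_of_degree (e j) (rho j).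

(** Taking the component of degree k, the generators of larger degree
    disappear. *)
Lemma generates_homog k r : D r -> homog_of_degree k r ->
  exists c : I -> S, r = \sum_(j | (e j <= k)%N) c j *: rho j.
Proof.
case/genD=> c rE homr; exists (fun j => pihomog mdeg (k - e j) (c j)).
apply/rowP=> i; rewrite -(pihomog_dE (homr i)) rE !summxE raddf_sum /= [RHS]big_mkcond /=.
by apply: eq_big => [j|j _]; rewrite ?inE // !mxE (pihomogMr _ _ (homrho j i)).
Qed.

(** All the homogeneous components of r have degree less than that of every
    generator. *)
Lemma generates_low_degree k r : (forall j, (k <= e j)%N) -> D r ->
  (forall i, (msize (r 0%R i) <= k)%N) -> r = 0.
Proof.
move=> lek /genD[c rE] sz; apply/rowP=> i.
rewrite mxE (pihomog_partitionE (sz i)) big1 // => l _.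
rewrite rE summxE raddf_sum big1 //= => j _.
rewrite mxE (pihomogMr _ _ (homrho j i)) leqNgt (leq_trans (ltn_ord l) (lek j)) //.
Qed.

End Graded.

Section Minimal.
Variables (K : fieldType) (I : finType) (D : 'rV[{mpoly K[3]}]_3 -> Prop).
Variable rho : I -> 'rV[{mpoly K[3]}]_3.
Hypothesis minD : minimally_generates D rho.

(** Substituting the expression of rho i into any combination shows that the
    remaining generators suffice. *)
Lemma minimal_not_redundant i (c : I -> {mpoly K[3]}) :
  rho i <> \sum_(j | j != i) c j *: rho j.
Proof.
move=> rhoE; have [gen mn] := minD; apply: (mn [set~ i]).
  by rewrite properE subsetT; apply/subsetPn; exists i; rewrite ?inE ?eqxx.
move=> r; split=> [/gen[b ->]|[b ->]].
  exists (fun j => b j + b i * c j); rewrite (bigD1 i) ?inE //= rhoE.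
  rewrite scaler_sumr [\sum_(_ in [set: I] | _) _](eq_bigl (fun j => j != i)) => [|j]; last by rewrite inE.
  rewrite [RHS](eq_bigl (fun j => j != i)) => [|j]; last by rewrite !inE.
  by rewrite -big_split; apply: eq_bigr => j _ /=; rewrite scalerA -scalerDl addrC.
apply/gen; exists (fun j => if j == i then 0 else b j).
rewrite [RHS](bigD1 i) ?inE //= eqxx scale0r add0r.
by apply: eq_big => [j|j]; rewrite !inE //= => /negbTE ->.
Qed.

Lemma minimal_mem i : D (rho i).
Proof.
apply/(minD.1); exists (fun j => (j == i)%:R); rewrite (bigD1 i) ?inE //= eqxx scale1r.
by rewrite big1 ?addr0 // => j /andP[_ /negbTE ->]; rewrite scale0r.
Qed.

Lemma minimal_not_multiple i j h : i != j -> rho i <> h *: rho j.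
Proof.
move=> ne e; apply: (@minimal_not_redundant i (fun k => if k == j then h else 0)).
rewrite e (bigD1 j) 1?eq_sym //= eqxx big1 ?addr0 // => k /andP[_ /negbTE ->].
by rewrite scale0r.
Qed.

Lemma minimal_neq0 i : rho i != 0.
Proof.
apply/eqP=> e; apply: (@minimal_not_redundant i (fun=> 0)).
by rewrite e big1 // => j _; rewrite scale0r.
Qed.

End Minimal.

(** * Saito's criterion *)

Section Saito.
Variables (K : fieldType) (d : nat) (A : line_arrangement K d).
Hypothesis nzd : d%:R != 0 :> K.
Local Notation S := {mpoly K[3]}.
Variables (r s : 'rV[S]_3) (k l : nat).
Hypotheses (syz_r : syzygy A r) (syz_s : syzygy A s).
Hypotheses (homr : homog_of_degree k r) (homs : homog_of_degree l s).
Hypothesis rs : cross r s != 0.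

Let nzdS : d%:R != 0 :> S.
Proof. by rewrite -mpolyC_nat mpolyC_eq0. Qed.

Lemma triple_syzygies : exists2 q,
  dot (coord_vec K) (cross r s) = arr_poly A * q /\ q != 0 &
  forall i, d%:R * cross r s 0 i = q * (arr_poly A)^`M(i).
Proof.
have [q Eq E] := cross_syzygies syz_r syz_s; exists q => //; split=> //.
have /rV0Pn[i nzi] := rs; apply: contraNneq nzi => q0.
by have /eqP := E i; rewrite q0 mul0r mulf_eq0 (negbTE nzdS).
Qed.

Lemma triple_homog : dot (coord_vec K) (cross r s) \is (1 + (k + l)).-homog.
Proof.
apply: rpred_sum => i _; apply: dhomogM.
  by rewrite mxE dhomogX; apply/eqP/mdeg1.
by rewrite mxE; apply: rpredB; apply: dhomogM (homr _) (homs _).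
Qed.

(** The excess n is the degree of the quotient q of X . (r x s) by f. *)
Lemma degree_sum_eq : exists2 n, (1 + (k + l) = d + n)%N &
  n = 0%N -> exists2 c : K, c != 0 &
    forall i, d%:R * cross r s 0 i = c *: (arr_poly A)^`M(i).
Proof.
have [q [Eq nzq] E] := triple_syzygies.
have nzf := arr_poly_neq0 A; have nz : dot (coord_vec K) (cross r s) != 0.
  by rewrite Eq mulf_neq0.
have := dhomog_msizeE nz triple_homog; rewrite Eq msizeM //.
rewrite (dhomog_msizeE nzf (arr_poly_homog A)) (mpolySpred _ nzq) addSn addnS /=.
case=> e; exists (msize q).-1 => // q0.
have /eqP/msize_poly1P [c nzc qc] : msize q = 1%N by rewrite (mpolySpred _ nzq) q0.
by exists c => // i; rewrite E qc mul_mpolyC.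
Qed.

Lemma degree_sum_ge : (d <= k + l + 1)%N.
Proof. by have [n] := degree_sum_eq; lia. Qed.

(** Here d (r x s) = c grad f with c a nonzero constant, so the cross product of
    any two syzygies is a multiple of r x s.  If u x s = x (r x s) and
    u x r = y (r x s), then u - x r + y s is proportional to both r and s,
    and so it is zero. *)
Lemma saito_free : (k + l + 1 = d)%N -> free_arrangement A.
Proof.
move=> kl; have [n nE] := degree_sum_eq.
case=> [|c nzc E]; first by lia.
have multiple u v : syzygy A u -> syzygy A v -> exists a, cross u v = a *: cross r s.
  move=> su sv; have [q _ Eq] := cross_syzygies su sv.
  exists (c^-1 *: q); apply/rowP=> i; rewrite [RHS]mxE; apply: (mulfI nzdS).
  by rewrite mulrCA E Eq -scalerAr -scalerAl scalerA divff // scale1r.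
pose b (i : 'I_2) := if i == 0 then r else s.
have sumE (a : 'I_2 -> S) : \sum_i a i *: b i = a 0 *: r + a 1 *: s.
  by rewrite big_ord_recl big_ord1 /b /=; congr (_ + a _ *: _); apply: val_inj.
exists 2, b; split.
  move=> u; split=> [su|[a ->]]; last first.
    under eq_bigl do rewrite inE.
    rewrite sumE; apply/syzygyE; move/syzygyE: syz_r => er; move/syzygyE: syz_s => es.
    transitivity (a 0 * dot r (grad (arr_poly A)) + a 1 * dot s (grad (arr_poly A))).
      rewrite /dot !mulr_sumr -big_split; apply: eq_bigr => i _.
      by rewrite !mxE /=; ring.
    by rewrite er es !mulr0 addr0.
  have [x ex] := multiple u s su syz_s; have [y ey] := multiple u r su syz_r.
  exists (fun i => if i == 0 then x else - y).
  under eq_bigl do rewrite inE.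
  rewrite sumE /=; pose w := 1 *: u + (-1) *: (x *: r + (- y) *: s).
  have ws : cross w s = 0.
    by rewrite !cross_lin crossvv scaler0 addr0 ex scaleN1r scale1r subrr.
  have wr : cross w r = 0.
    rewrite !cross_lin crossvv scaler0 add0r ey (crossC s r).
    by rewrite scale1r scaleN1r scaleNr scalerN opprK subrr.
  have w0 : w = 0.
    apply: contraNeq rs => /rV0Pn[i nzi]; apply/eqP/cross_eq0P.
    apply: proportional_trans nzi _ _; last exact/cross_eq0P.
    by move/cross_eq0P: wr => wr i' j'; rewrite mulrC -wr mulrC.
  by apply/eqP; rewrite -subr_eq0 -w0 /w scale1r scaleN1r.
move=> a; rewrite sumE => a0.
have a0s : a 0 *: cross r s = 0.
  have := cross_lin (a 0) (a 1) r s s.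
  by rewrite a0 cross0v crossvv scaler0 addr0.
have a1s : a 1 *: cross r s = 0.
  have := cross_lin (a 0) (a 1) r s r.
  by rewrite a0 cross0v crossvv scaler0 add0r (crossC s r) scalerN => /esym/eqP; rewrite oppr_eq0 => /eqP.
have /rV0Pn[i nzi] := rs.
have z x : x *: cross r s = 0 -> x = 0.
  by move=> /rowP/(_ i)/eqP; rewrite [X in X == _]mxE [X in _ == X]mxE mulf_eq0 (negbTE nzi) orbF => /eqP.
case=> [[|[|//]]] lt.
  by rewrite -(z _ a0s); congr a; apply: val_inj.
by rewrite -(z _ a1s); congr a; apply: val_inj.
Qed.

End Saito.

(** * The exponents *)

(** Let v be the primitive part of rho i1 = g v; it is a syzygy, and rho i2 is a
    multiple of it.  If g is not constant, the entries of v have degree below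
    that of every generator, so v = 0.  If g is constant, rho i2 is a multiple
    of rho i1. *)
Lemma generators_independent (K : fieldType) d (A : line_arrangement K d)
    (I : finType) (rho : I -> 'rV[{mpoly K[3]}]_3) (e : I -> nat) i1 i2 :
  minimally_generates (syzygy A) rho -> (forall j, homog_of_degree (e j) (rho j)) ->
  i1 != i2 -> (forall j, e i1 <= e j)%N -> cross (rho i1) (rho i2) != 0.
Proof.
move=> minD hom ne low; apply/eqP=> /cross_eq0P par.
have /rV0Pn[k nzk] := minimal_neq0 minD i1.
have [g [v [ev prv]]] := has_primitive_parts_mpoly nzk.
have nzg : g != 0 by apply: contraNneq nzk => g0; rewrite ev g0 mul0r.
have nzv : v k != 0 by apply: contraNneq nzk => v0; rewrite ev v0 mulr0.
have [h eh] : exists h, forall i, rho i2 0 i = h * v i.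
  apply: prv; apply: proportional_trans nzk _ par => i j.
  by rewrite !ev; ring.
have sv : syzygy A (\row_i v i).
  have /syzygyE := minimal_mem minD i1; rewrite /dot => e0; apply/syzygyE; apply: (mulfI nzg).
  rewrite mulr0 -[RHS]e0 /dot mulr_sumr; apply: eq_bigr => i _.
  by rewrite [X in g * (X * _)]mxE ev mulrA.
have sg : (msize g <= 1)%N.
  rewrite leqNgt; apply: contraNN nzv => sg; apply/eqP.
  suff /rowP/(_ k) : \row_i v i = 0 by rewrite !mxE.
  apply: (generates_low_degree minD.1 hom low sv) => i; rewrite mxE.
  have [->|nzi] := eqVneq (v i) 0; first by rewrite msize0.
  have nzri : rho i1 0 i != 0 by rewrite ev mulf_neq0.
  have := dhomog_msizeE nzri (hom i1 i); rewrite ev msizeM //; move: sg.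
  by move: (msize g) (msize (v i)) => a b; lia.
have /msize_poly1P[c nzc gc] : msize g == 1%N.
  by rewrite eqn_leq sg; rewrite (mpolySpred _ nzg).
apply: (minimal_not_multiple (i := i2) (j := i1) (h := c^-1 *: h) minD).
  by rewrite eq_sym.
apply/rowP=> i; rewrite mxE eh ev gc mulrA; congr (_ * _).
by rewrite mulrC mul_mpolyC scalerA divff // scale1r.
Qed.

Section Exponents.
Variables (K : fieldType) (d : nat) (A : line_arrangement K d).
Hypothesis nzd : d%:R != 0 :> K.
Variables (ds : seq nat) (hds : exponents A ds).

Lemma first_exponent_le r k : syzygy A r -> homog_of_degree k r -> r != 0 ->
  (nth 0%N ds 0 <= k)%N.
Proof.
move=> sr homr; have [srt [rho [minD hom]]] := hds.
have [c ->] := generates_homog minD.1 hom sr homr; rewrite leqNgt; apply: contraNN => lt.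
rewrite big1 // => j; rewrite leqNgt (leq_trans lt) //.
apply: sorted_leq_nth => //; [exact: leq_trans | by rewrite inE (leq_ltn_trans _ (ltn_ord j)) | by rewrite inE].
Qed.

(** Otherwise r and s involve no generator but the first one, and are
    proportional. *)
Lemma second_exponent_le r s k l : syzygy A r -> syzygy A s ->
  homog_of_degree k r -> homog_of_degree l s -> (k <= l)%N -> cross r s != 0 ->
  (1 < size ds)%N /\ (nth 0%N ds 1 <= l)%N.
Proof.
move=> sr ss homr homs lekl; have [srt [rho [minD hom]]] := hds.
have [/andP//|big] := boolP ((1 < size ds)%N && (nth 0%N ds 1 <= l)%N).
have small (j : 'I_(size ds)) : (nth 0%N ds j <= l)%N -> j = 0%N :> nat.
  case: (posnP j) => // j0 le; case/negP: big.
  have lt := leq_ltn_trans j0 (ltn_ord j); rewrite lt (leq_trans _ le) //.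
  by apply: sorted_leq_nth => //; exact: leq_trans.
have [c ->] := generates_homog minD.1 hom sr homr.
have [b ->] := generates_homog minD.1 hom ss homs.
case/eqP; apply/cross_eq0P => i1 i2; rewrite !summxE !mulr_suml.
apply: eq_bigr => j lej; have j0 := small j (leq_trans lej lekl).
rewrite !mulr_sumr; apply: eq_bigr => j' /small j'0.
have -> : j' = j by apply: val_inj; rewrite /= j0 j'0.
by rewrite !mxE; ring.
Qed.

Lemma exponents_sum : (1 < size ds)%N ->
  (d <= nth 0 ds 0 + nth 0 ds 1 + 1)%N /\
  ((nth 0 ds 0 + nth 0 ds 1 + 1 = d)%N -> free_arrangement A).
Proof.
move=> s1; have [srt [rho [minD hom]]] := hds; have s0 := ltnW s1.
have syz := minimal_mem minD.
have ind : cross (rho (Ordinal s0)) (rho (Ordinal s1)) != 0.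
  apply: generators_independent minD hom _ _ => // j /=.
  by apply: sorted_leq_nth => //; exact: leq_trans.
have h0 := hom (Ordinal s0); have h1 := hom (Ordinal s1).
split; first exact: (degree_sum_ge nzd (syz _) (syz _) h0 h1 ind).
exact: (saito_free nzd (syz _) (syz _) h0 h1 ind).
Qed.

End Exponents.

Lemma mult_le (K : fieldType) d (A : line_arrangement K d) p : (mult A p <= d)%N.
Proof. by rewrite -[X in (_ <= X)%N]card_ord max_card. Qed.

Theorem theorem4p6 (R : realType) (d : nat) (hd : (3 <= d)%N)
    (A : line_arrangement R[i] d)
    (ds : seq nat) (hds : exponents A ds)
    (m : nat) (hm : is_max_mult A m)
    (p : 'rV[R[i]]_3) (hp : on_curve A p) (hpm : mult A p = m)
    (n : nat) (hn : is_max_mult_away A p n) :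
  let d1 := nth 0%N ds 0 in
  let d2 := nth 0%N ds 1 in
  let t := arr_type d d1 d2 in
  [/\ [/\ m%:Z - 1 <= t + m%:Z - 1,
          t + m%:Z - 1 <= d2%:Z
        & d2%:Z <= d%:Z - n%:Z],
      d2%:Z = m%:Z - 1 ->
        free_arrangement A /\ d1%:Z = d%:Z - m%:Z,
      ~ free_arrangement A -> (m <= d2)%N
    & 0 <= t /\ t <= d%:Z + 1 - m%:Z - n%:Z].
Proof.
move=> d1 d2 t.
have nzd : d%:R != 0 :> R[i] by rewrite Num.Theory.pnatr_eq0; lia.
have [[q [hq nqp] hqn] _] := hn.
have nm : (n <= m)%N by rewrite -hqn; apply: hm.2.
have md : (m <= d)%N by rewrite -hpm mult_le.
have ind := cross_point_syzygy (A := A) nzd hp.1 hq.1 nqp.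
have homp : homog_of_degree (d - m) (point_syzygy A p).
  by rewrite -hpm; exact: point_syzygy_homog.
have homq : homog_of_degree (d - n) (point_syzygy A q).
  by rewrite -hqn; exact: point_syzygy_homog.
have syz := point_syzygy_syzygy A.
have cr : cross (point_syzygy A p) (point_syzygy A q) != 0 by exact/eqP.
have nzp : point_syzygy A p != 0.
  by apply: contraNneq cr => ->; rewrite cross0v eqxx.
have d1m : (d1 <= d - m)%N := first_exponent_le hds (syz p) homp nzp.
have [|s1 d2n] := second_exponent_le hds (syz p) (syz q) homp homq _ cr; first exact: leq_sub2l.
have [sum_ge free] := exponents_sum nzd hds s1.
rewrite -/d1 -/d2 in sum_ge free d2n.
have tE : t = d1%:Z + d2%:Z - d%:Z + 1 by [].
clearbody t d1 d2.
have d2m : (d2 + 1 = m)%N -> free_arrangement A /\ (d1 + m = d)%N.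
  by move=> e; have e1 : (d1 + m = d)%N; [lia | split; [apply: free; lia | ]].
split; [split; lia| | |split; lia].
- by move=> e; have [|fr e1] := d2m; [lia | split=> //; lia].
- move=> nfree; have [/d2m[]|ne] := eqVneq (d2 + 1)%N m; first by move/nfree.
  by move/eqP: ne; lia.
Qed.
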